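(* Let $X,Y$ be compact Hausdorff spaces and $E$ a unital Banach algebra with unit $e_0$. Let $H:C(X,E)\to C(Y,E)$ be separating and strongly pointwise subadditive with support map $h:Y\to X$, and assume $\|H1_{e_0}(y)\|\ne0$ for all $y\in Y$. Let $Y_c=\{y\in Y:\hat y\circ H\text{ is continuous}\}$. Then: (a) if $y\in Y_c$, then $Hf(y)=H(1_{f(h(y))})(y)$ for all $f\in C(X,E)$; (b) if $H$ is $1_{e_0}$-bounded, then for $y\in Y$ we have $y\in Y_c$ if and only if $Hf(y)=H(1_{f(h(y))})(y)$ for all $f\in C(X,E)$.
   Context: $C(X,E)$ is the space of continuous functions $X\to E$ with the supremum norm. For $f\in C(X,E)$, $\operatorname{coz}(f)=\{x\in X:f(x)\ne0\}$. For $e\in E$, $1_e\in C(X,E)$ is the constant function with value $e$. Maps $H:C(X,E)\to C(Y,E)$ are not assumed linear. $H$ is separating if, for all $f,g\in C(X,E)$, $\|f(x)\|\,\|g(x)\|=0$ for all $x\in X$ implies $\|Hf(y)\|\,\|Hg(y)\|=0$ for all $y\in Y$. $H$ is pointwise subadditive if $\|H(f+g)(y)\|\le\|Hf(y)\|+\|Hg(y)\|$ for all $f,g\in C(X,E)$, $y\in Y$. For $y\in Y$, $\hat y\circ H:C(X,E)\to E$ is $f\mapsto Hf(y)$. An open set $U\subseteq X$ is a vanishing set for $\hat y\circ H$ if for each $f\in C(X,E)$, $\operatorname{coz}(f)\subseteq U$ implies $Hf(y)=0$. The support is $\operatorname{supp}(\hat y\circ H)=X\setminus\bigcup\{V\subseteq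 X: V\text{ is a vanishing set for }\hat y\circ H\}$. If $H$ is separating and pointwise subadditive with $\|H1_{e_0}(y)\|\ne0$ for all $y\in Y$, then each $\operatorname{supp}(\hat y\circ H)$ is a singleton $\{h(y)\}$; the resulting map $h:Y\to X$ is the support map of $H$. A pointwise subadditive separating map $H$ with support map $h$ is strongly pointwise subadditive if for each $y\in Y$ there is $M_y>0$, and for each $c\in E$ there is $\delta_{c,y}>0$, such that $\|Hf(y)-Hg(y)\|\le M_y\|H(f-g)(y)\|$ for all $f,g\in C(X,E)$ with $f(h(y))=c$ and $\|f(h(y))-g(h(y))\|<\delta_{c,y}$. $H$ is $1_{e_0}$-bounded if there exists $D>0$ such that $\|H(1_e)\|\le D\,\|H(1_{e_0})\|\,\|e\|$ for all $e\in E$ (supremum norms on $C(Y,E)$). *)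

(* Defs.v *)
From HB Require Import structures.
From mathcomp Require Import all_boot all_order all_algebra.
From mathcomp Require Import all_classical all_reals all_analysis.
From mathcomp Require Import complex.
Import Order.TTheory GRing.Theory Num.Theory.
Import numFieldNormedType.Exports.

Set Implicit Arguments.
Unset Strict Implicit.
Unset Printing Implicit Defensive.

Local Open Scope classical_set_scope.
Local Open Scope ring_scope.

(* In the library the norm of a normed space takes its values in the field of
   scalars, so real and complex spaces are normed over different fields.  In
   R[i], 0 <= z and 0 < z entail that z is real. *)
Variant scalars := RealScalars | ComplexScalars.

Definition scalar_field (R : realType) (s : scalars) : numFieldType :=
  match s with RealScalars => R | ComplexScalars => R[i] end.

(* The multiplication is not that of [GRing.Algebra]: Hierarchy Builder rejects a
   join of rings and normed modules declared above [Num.NumDomain], which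
   already has a ring structure and a norm.  The norm of the unit is not
   required to be 1. *)
HB.mixin Record NormedModule_isNormedAlgebra (K : numFieldType) E
    & NormedModule K E := {
  bmul : E -> E -> E;
  bone : E;
  bmulA : associative bmul;
  bmul1x : left_id bone bmul;
  bmulx1 : right_id bone bmul;
  bmulDl : left_distributive bmul +%R;
  bmulDr : right_distributive bmul +%R;
  bmulZl : forall (a : K) (x y : E), bmul (a *: x) y = a *: bmul x y;
  bmulZr : forall (a : K) (x y : E), bmul x (a *: y) = a *: bmul x y;
  norm_bmul_le : forall x y : E, `|bmul x y| <= `|x| * `|y|
}.

#[short(type="banachAlgType")]
HB.structure Definition BanachAlgebra (K : numFieldType) :=
  {E of CompleteNormedModule K E & NormedModule_isNormedAlgebra K E}.

HB.mixin Record isCompactHausdorff X & Topological X := {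
  compactT : compact [set: X];
  hausdorffT : hausdorff_space X
}.

#[short(type="compactHausdorffType")]
HB.structure Definition CompactHausdorff :=
  {X of Topological X & isCompactHausdorff X}.

Notation "'C(' X , E )" := (continuousType X E)
  (at level 8, format "'C(' X ,  E )") : type_scope.

Section ContinuousLmodule.
Context {K : numFieldType} {X : topologicalType} {E : normedModType K}.
Implicit Types (f g : C(X, E)) (a : K).

Let cts0 : continuous (fun _ : X => 0 : E).
Proof. by move=> x; exact: cvg_cst. Qed.

Let ctsN f : continuous (fun x => - f x).
Proof. by move=> x; apply: continuousN; exact: cts_fun. Qed.

Let ctsD f g : continuous (fun x => f x + g x).
Proof. by move=> x; apply: continuousD; exact: cts_fun. Qed.

Let ctsZ a f : continuous (fun x => a *: f x).
Proof. by move=> x; apply: continuousZl_tmp; exact: cts_fun. Qed.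

Definition ctsfun_zero : C(X, E) := mkcts cts0.
Definition ctsfun_opp f : C(X, E) := mkcts (@ctsN f).
Definition ctsfun_add f g : C(X, E) := mkcts (@ctsD f g).
Definition ctsfun_scale a f : C(X, E) := mkcts (@ctsZ a f).

Let addA : associative ctsfun_add.
Proof. by move=> f g k; apply/continuousEP => x; exact: addrA. Qed.
Let addC : commutative ctsfun_add.
Proof. by move=> f g; apply/continuousEP => x; exact: addrC. Qed.
Let add0 : left_id ctsfun_zero ctsfun_add.
Proof. by move=> f; apply/continuousEP => x; exact: add0r. Qed.
Let addN : left_inverse ctsfun_zero ctsfun_opp ctsfun_add.
Proof. by move=> f; apply/continuousEP => x; exact: addNr. Qed.

HB.instance Definition _ :=
  GRing.isZmodule.Build C(X, E) addA addC add0 addN.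

Let scaleA a b f : ctsfun_scale a (ctsfun_scale b f) = ctsfun_scale (a * b) f.
Proof. by apply/continuousEP => x; exact: scalerA. Qed.
Let scale1 : left_id 1 ctsfun_scale.
Proof. by move=> f; apply/continuousEP => x; exact: scale1r. Qed.
Let scaleDr : right_distributive ctsfun_scale +%R.
Proof. by move=> a f g; apply/continuousEP => x; exact: scalerDr. Qed.
Let scaleDl f : {morph ctsfun_scale^~ f : a b / a + b}.
Proof. by move=> a b; apply/continuousEP => x; exact: scalerDl. Qed.

HB.instance Definition _ := GRing.Zmodule_isLmodule.Build K C(X, E)
  scaleA scale1 scaleDr scaleDl.

Lemma ctsfun0E (x : X) : (0 : C(X, E)) x = 0. Proof. by []. Qed.
Lemma ctsfunNE f x : (- f) x = - f x. Proof. by []. Qed.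
Lemma ctsfunDE f g x : (f + g) x = f x + g x. Proof. by []. Qed.
Lemma ctsfunBE f g x : (f - g) x = f x - g x. Proof. by []. Qed.
Lemma ctsfunZE a f x : (a *: f) x = a *: f x. Proof. by []. Qed.

End ContinuousLmodule.

Lemma scalar_supremums (R : realType) (s : scalars)
    (A : set (scalar_field R s)) :
    A !=set0 -> A `<=` [set x | 0 <= x] -> ubound A !=set0 ->
  supremums A !=set0.
Proof.
case: s A => A [a Aa] A0 [b ubA] /=.
  have sA : has_sup A by split; [exists a | exists b].
  exists (sup A); split; first exact: sup_upper_bound.
  by move=> c ubc; apply: ge_sup => //; exists a.
have im0 x : 0 <= x :> R[i] -> x = (complex.Re x)%:C%C.
  by case: x => r i; rewrite lecE /= => /andP[/eqP-> _].
pose B : set R := [set complex.Re x | x in A].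
have b0 : 0 <= b by exact: le_trans (A0 _ Aa) (ubA _ Aa).
have sB : has_sup B.
  split; first by exists (complex.Re a), a.
  exists (complex.Re b) => _ [x Ax <-].
  by have := ubA _ Ax; rewrite lecE => /andP[].
exists (sup B)%:C%C; split.
  move=> x Ax; rewrite (im0 _ (A0 _ Ax)) lecR.
  by apply: sup_upper_bound => //; exists x.
move=> c ubc; have c0 : 0 <= c by exact: le_trans (A0 _ Aa) (ubc _ Aa).
rewrite (im0 _ c0) lecR; apply: ge_sup; first by case: sB.
by move=> _ [x Ax <-]; have := ubc _ Ax; rewrite lecE => /andP[].
Qed.

Section SupNorm.
Context {R : realType} {s : scalars}.
Local Notation K := (scalar_field R s).
Context {X : compactHausdorffType} {E : normedModType K}.
Implicit Types (f g : C(X, E)).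

(* [supremum] is the least upper bound for the order of K, a partial one when
   K = R[i]; it is 0 when X is empty. *)
Definition sup_norm f : K := supremum 0 (range (fun x => `|f x|)).

Let normf_bounded f : ubound (range (fun x => `|f x|)) !=set0.
Proof.
have /compact_near_coveringP cX := @compactT X.
have : \forall M \near +oo_K, forall x, [set: X] x -> `|f x| <= M.
  apply: cX => x _.
  have fx : \forall y \near x, `|f x - f y| < 1.
    by have /cvgrPdist_lt := @cts_fun _ _ f x; apply.
  near=> y M => /=.
  have -> : f y = f x - (f x - f y) by rewrite opprB addrC subrK.
  apply: (le_trans (ler_normB _ _)).
  apply: (@le_trans _ _ (`|f x| + 1)); last first.
    by near: M; apply: nbhs_pinfty_ge; rewrite realD.
  by rewrite lerD2l ltW//; near: y.
move=> Mf; near +oo_K => M; exists M => _ [x _ <-].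
suff : forall x, [set: X] x -> `|f x| <= M by apply.
by near: M; exact: Mf.
Unshelve. all: by end_near. Qed.

Let sup_normP f (x0 : X) : supremums (range (fun x => `|f x|)) (sup_norm f).
Proof.
have A0 : range (fun x => `|f x|) !=set0 by exists `|f x0|, x0.
have Age0 : range (fun x => `|f x|) `<=` [set r | 0 <= r] by move=> _ [x _ <-] /=.
have [r supr] := scalar_supremums A0 Age0 (normf_bounded f).
rewrite /sup_norm /supremum ifF; last by apply/negbTE/set0P.
by case: xgetP => // /(_ r).
Qed.

Let sup_norm_empty f : ~ ([set: X] !=set0) -> sup_norm f = 0.
Proof.
move=> X0; rewrite -(supremum0 (0 : K)) /sup_norm; congr supremum.
by rewrite -subset0 => r [x _ _]; apply: X0; exists x.
Qed.

Lemma norm_le_sup_norm f x : `|f x| <= sup_norm f.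
Proof. by have [+ _] := sup_normP f x; apply; exists x. Qed.

Lemma sup_norm_le f (M : K) :
  0 <= M -> (forall x, `|f x| <= M) -> sup_norm f <= M.
Proof.
move=> M0 fM; have [[x0 _]|X0] := pselect ([set: X] !=set0).
  by have [_ +] := sup_normP f x0; apply => _ [x _ <-].
by rewrite sup_norm_empty.
Qed.

Let sup_norm_ge0 f : 0 <= sup_norm f.
Proof.
have [[x0 _]|X0] := pselect ([set: X] !=set0).
  exact: le_trans (normr_ge0 _) (norm_le_sup_norm f x0).
by rewrite sup_norm_empty.
Qed.

Let sup_normD f g : sup_norm (f + g) <= sup_norm f + sup_norm g.
Proof.
apply: sup_norm_le => [|x]; first by rewrite addr_ge0.
by apply: le_trans (ler_normD _ _) _; rewrite lerD ?norm_le_sup_norm.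
Qed.

Let sup_normZ_le a f : sup_norm (a *: f) <= `|a| * sup_norm f.
Proof.
apply: sup_norm_le => [|x]; first by rewrite mulr_ge0.
by rewrite ctsfunZE normrZ ler_wpM2l ?norm_le_sup_norm.
Qed.

Let sup_normZ a f : sup_norm (a *: f) = `|a| * sup_norm f.
Proof.
apply/eqP; rewrite eq_le sup_normZ_le /=; have [->|a0] := eqVneq a 0.
  by rewrite normr0 mul0r.
rewrite mulrC -ler_pdivlMr ?normr_gt0// mulrC -normfV.
by have := sup_normZ_le a^-1 (a *: f); rewrite scalerA mulVf// scale1r.
Qed.

Let sup_norm0 f : sup_norm f = 0 -> f = 0.
Proof.
move=> f0; apply/continuousEP => x; apply/eqP; rewrite -normr_le0 -f0.
exact: norm_le_sup_norm.
Qed.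

HB.instance Definition _ :=
  Lmodule_isNormed.Build K C(X, E) sup_normD sup_normZ sup_norm0.

Lemma normE f : `|f| = sup_norm f. Proof. by []. Qed.

End SupNorm.

Section Maps.
Context {R : realType} {s : scalars}.
Local Notation K := (scalar_field R s).
Context {E : banachAlgType K} {X Y : compactHausdorffType}.
Implicit Types (H : C(X, E) -> C(Y, E)) (phi : C(X, E) -> E).

Definition coz (f : C(X, E)) : set X := [set x | f x != 0].

Definition separating H := forall f g : C(X, E),
  (forall x, `|f x| * `|g x| = 0) -> forall y, `|H f y| * `|H g y| = 0.

Definition pointwise_subadditive H := forall (f g : C(X, E)) y,
  `|H (f + g) y| <= `|H f y| + `|H g y|.

Definition eval_at H (y : Y) : C(X, E) -> E := fun f => H f y.

Definition vanishing_set phi (U : set X) :=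
  open U /\ forall f, coz f `<=` U -> phi f = 0.

Definition supp phi : set X := ~` \bigcup_(V in vanishing_set phi) V.

Definition support_map H (h : Y -> X) :=
  forall y, supp (eval_at H y) = [set h y].

Definition strongly_pointwise_subadditive H (h : Y -> X) :=
  pointwise_subadditive H /\
  forall y, exists2 M : K, 0 < M & forall c : E,
    exists2 delta : K, 0 < delta & forall f g : C(X, E),
      f (h y) = c -> `|f (h y) - g (h y)| < delta ->
      `|H f y - H g y| <= M * `|H (f - g) y|.

(* Continuity is for the topology of the supremum norm on C(X, E). *)
Definition continuity_points H : set Y := [set y | continuous (eval_at H y)].

End Maps.

Definition const_fun {R : realType} {s : scalars}
  {E : banachAlgType (scalar_field R s)} {X : compactHausdorffType} (e : E) :
  C(X, E) := cst e.

Notation "'1_[' e ]" := (const_fun e) (at level 8, format "'1_[' e ]").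

Definition unit_bounded {R : realType} {s : scalars}
    {E : banachAlgType (scalar_field R s)} {X Y : compactHausdorffType}
    (H : C(X, E) -> C(Y, E)) :=
  exists2 D : scalar_field R s, 0 < D &
    forall e : E, `|H 1_[e]| <= D * `|H 1_[bone]| * `|e|.

(* Main.v *)
Require Import Defs.
From HB Require Import structures.
From mathcomp Require Import all_boot all_order all_algebra.
From mathcomp Require Import all_classical all_reals all_analysis.
From mathcomp Require Import complex.
Import Order.TTheory GRing.Theory Num.Theory.
Import numFieldNormedType.Exports.
Local Open Scope classical_set_scope.
Local Open Scope ring_scope.

(* Strong subadditivity with g = 1_[f (h y)] reduces (a) to: k (h y) = 0 implies
   H k y = 0.  If k vanishes near h y, this holds because H is separating and
   every neighbourhood of h y contains the cozero set of some f with H f y <> 0.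
   A general k is a uniform limit of truncations vanishing near h y.
   Conversely, if H f y depends only on f (h y), strong subadditivity and
   boundedness give |H f y - H g y| <= C |f - g| for g near f. *)

Section Truncation.
Context {K : numFieldType} {X : topologicalType} {E : normedModType K}.

(* max (t - eps) 0 / max t eps, with the maxima written with norms because the
   order of K may be partial. *)
Definition trunc_coef (eps t : K) : K :=
  (t - eps + `|t - eps|) / (t + eps + `|t - eps|).

Lemma trunc_coef_den_gt0 (eps t : K) : 0 < eps -> 0 <= t ->
  0 < t + eps + `|t - eps|.
Proof. by move=> e0 t0; rewrite ltr_wpDr// ltr_wpDl. Qed.

Lemma trunc_coef_small (eps t : K) : t < eps -> trunc_coef eps t = 0.
Proof.
by move=> te; rewrite /trunc_coef ltr0_norm ?subr_lt0// subrr mul0r.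
Qed.

(** The difference [1 - trunc_coef eps t] equals [2 eps / (t + eps + |t - eps|)], whose denominator
    is at least [t]. With [t = |k x|] this bounds the truncation error by [2 eps], uniformly in
    [x]. *)
Lemma trunc_coefB (eps t : K) : 0 < eps -> 0 <= t ->
  `|1 - trunc_coef eps t| * t <= eps *+ 2.
Proof.
move=> e0 t0; have d0 := trunc_coef_den_gt0 _ _ e0 t0.
have -> : 1 - trunc_coef eps t = eps *+ 2 / (t + eps + `|t - eps|).
  rewrite /trunc_coef -[X in X - _](divff (lt0r_neq0 d0)) -mulrBl; congr (_ / _).
  by rewrite opprD addrACA subrr addr0 opprB addrC addrA subrK mulr2n.
have e20 : 0 <= eps *+ 2 by rewrite mulrn_wge0// ltW.
rewrite ger0_norm ?divr_ge0// ?(ltW d0)//.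
rewrite mulrAC ler_pdivrMr// ler_wpM2l//.
by rewrite -addrA lerDl addr_ge0// ltW.
Qed.

Lemma trunc_continuous (eps : K) (k : C(X, E)) : 0 < eps ->
  continuous (fun x => trunc_coef eps `|k x| *: k x).
Proof.
move=> e0 x; have nk : `|k z| @[z --> x] --> `|k x|.
  by apply: cvg_norm; exact: cts_fun.
have nke : `| `|k z| - eps | @[z --> x] --> `| `|k x| - eps |.
  by apply: cvg_norm; apply: cvgB => //; exact: cvg_cst.
apply: cvgZ; last exact: cts_fun.
apply: cvgM.
  by apply: cvgD => //; apply: cvgB => //; exact: cvg_cst.
apply: cvgV; first by rewrite lt0r_neq0// trunc_coef_den_gt0.
by apply: cvgD => //; apply: cvgD => //; exact: cvg_cst.
Qed.

End Truncation.

Section SupportMap.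
Context {R : realType} {s : scalars}.
Local Notation K := (scalar_field R s).
Context {E : banachAlgType K} {X Y : compactHausdorffType}.
Variables (H : C(X, E) -> C(Y, E)) (h : Y -> X).
Hypotheses (H_separating : separating H) (H_support_map : support_map H h).

Lemma separating_eval_near0 (k : C(X, E)) (y : Y) :
  (\forall x \near h y, k x = 0) -> H k y = 0.
Proof.
rewrite -nbhs_nearE nbhsE => -[U [oU Uhy] Uk].
have : ~ vanishing_set (eval_at H y) U.
  move=> vU; have : supp (eval_at H y) (h y) by rewrite H_support_map.
  by apply; exists U.
move=> /not_andP[//|/existsNP[f /not_implyP[fU /eqP Hf]]].
(* [k] is zero on [U] and [f] is zero off [U], so separation applies to the pair. *)
have kf x : `|k x| * `|f x| = 0.
  have [fx|fx] := eqVneq (f x) 0; first by rewrite fx normr0 mulr0.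
  by rewrite (Uk x (fU _ fx)) normr0 mul0r.
have /eqP := H_separating _ _ kf y.
by rewrite mulf_eq0 !normr_eq0 (negbTE Hf) orbF => /eqP.
Qed.

Lemma continuous_eval_eq0 (k : C(X, E)) (y : Y) :
  {for k, continuous (eval_at H y)} -> k (h y) = 0 -> H k y = 0.
Proof.
move=> /cvgrPdist_lt Hcts khy; apply/eqP; rewrite -normr_le0.
apply/ler_addgt0Pl => e e0; rewrite addr0.
have /nbhs_normP[d /= d0 dH] := Hcts e e0.
(* Truncating at [eps] costs up to [2 eps]; [eps = d / 3] keeps the error strictly below [d]. *)
have d3 : 0 < d / 3%:R by rewrite divr_gt0.
pose kd : C(X, E) := mkcts (trunc_continuous _ k d3).
have kdE x : kd x = trunc_coef (d / 3%:R) `|k x| *: k x by [].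
have Hkd : H kd y = 0.
  (* As [k (h y) = 0], near [h y] the norm of [k] is below [d / 3], where the coefficient is 0. *)
  apply: separating_eval_near0.
  have : `|k z| @[z --> h y] --> `|k (h y)|.
    by apply: cvg_norm; exact: cts_fun.
  rewrite khy normr0 => /cvgr0Pnorm_lt /(_ _ d3); apply: filterS => x.
  by rewrite normr_id => kx; rewrite kdE trunc_coef_small ?scale0r.
have /dH : ball_ Num.norm k d kd.
  apply: (@le_lt_trans _ _ ((d / 3%:R) *+ 2)); last first.
    by rewrite -mulr_natr mulrAC ltr_pdivrMr// ltr_pM2l// ltr_nat.
  rewrite normE; apply: sup_norm_le => [|x]; first by rewrite mulrn_wge0 ?ltW.
  rewrite ctsfunBE kdE -{1}[k x]scale1r -scalerBl normrZ.
  exact: trunc_coefB.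
by rewrite /= /eval_at Hkd subr0 => /ltW.
Qed.

End SupportMap.

Theorem theorem2p18 (R : realType) (s : scalars)
    (X Y : compactHausdorffType) (E : banachAlgType (scalar_field R s))
    (H : C(X, E) -> C(Y, E)) (h : Y -> X)
    (H_separating : separating H)
    (H_support_map : support_map H h)
    (H_strongly_subadditive : strongly_pointwise_subadditive H h)
    (H_unit_neq0 : forall y : Y, `|H 1_[bone] y| <> 0) :
  (forall y : Y, continuity_points H y ->
     forall f : C(X, E), H f y = H 1_[f (h y)] y)
  /\
  (unit_bounded H ->
     forall y : Y, continuity_points H y <->
       (forall f : C(X, E), H f y = H 1_[f (h y)] y)).
Proof.
have [_ strongH] := H_strongly_subadditive.
have eval_const y : continuity_points H y ->
    forall f : C(X, E), H f y = H 1_[f (h y)] y.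
  move=> cy f; have [M M0 /(_ (f (h y)))[d d0 Hd]] := strongH y.
  have H0 : H (f - 1_[f (h y)]) y = 0.
    apply: (continuous_eval_eq0 _ _ H_separating H_support_map _ _ (cy _)).
    exact: subrr.
  (* The two functions agree at [h y], so they are within [d] there, and the bound is [M * 0]. *)
  have := Hd f 1_[f (h y)] erefl; rewrite subrr normr0 H0 => /(_ d0).
  by rewrite normr0 mulr0 normr_le0 subr_eq0 => /eqP.
split=> // -[D D0 HD] y; split; first exact: eval_const.
move=> Hy f.
apply/(@cvgrPdist_le _ _ _ (nbhs f) _ (eval_at H y) (eval_at H y f)) => e e0.
have [M M0 /(_ (f (h y)))[d d0 Hd]] := strongH y.
(* A local Lipschitz constant at [f]; the added 1 makes it positive, so that [e / B] is a valid
   radius. *)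
pose B := M * (D * `|H 1_[bone]|) + 1.
have B0 : 0 < B by rewrite ltr_wpDl// !mulr_ge0// ltW.
have fy (g : C(X, E)) : `|f (h y) - g (h y)| <= `|f - g|.
  by rewrite -ctsfunBE; exact: norm_le_sup_norm.
have near_lt (r : scalar_field R s) : 0 < r -> \forall g \near f, `|f - g| < r.
  by move=> r0; apply/nbhs_normP; exists r.
near=> g.
have fgd : `|f - g| < d by near: g; exact: near_lt.
apply: le_trans (Hd f g erefl (le_lt_trans (fy g) fgd)) _.
(* [Hy] is used for [f - g]: only the constant function with value [(f - g) (h y)] remains, to which
   the bound [HD] applies. *)
rewrite Hy; apply: (@le_trans _ _ (B * `|f - g|)); last first.
  rewrite mulrC -ler_pdivlMr// ltW//.
  by near: g; apply: near_lt; rewrite divr_gt0.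
rewrite /B mulrDl -mulrA ler_wpDr ?mul1r// ler_wpM2l ?(ltW M0)//.
apply: le_trans (norm_le_sup_norm _ y) _; rewrite -normE.
apply: le_trans (HD _) _; rewrite ler_wpM2l ?mulr_ge0 ?(ltW D0)//.
exact: norm_le_sup_norm.
Unshelve. all: by end_near. Qed.
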